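(* Let $\alpha\in[0,1)$ and let $M=(M_\omega)_{\omega\in\Omega}$ be a quantum measurement that is $\alpha$-gentle on $\mathcal S(\mathbb C^d)$ and whose measurement operators $M_\omega$ are positive-definite. Then $M$ is $\delta$-quantum-differentially-private on $\mathcal S(\mathbb C^d)$ for $$\delta=2\log\Big(\frac{1+\alpha}{1-\alpha}\Big)=4\,\mathrm{arctanh}(\alpha).$$
   Context: $\mathcal S(\mathbb C^d)$ is the set of density matrices (positive semidefinite, trace 1) on $\mathbb C^d$. A measurement on $\mathbb C^d$ is a countable family $M=(M_\omega)_{\omega\in\Omega}$ of matrices in $\mathbb C^{d\times d}$ with $\sum_\omega M_\omega^*M_\omega=\mathbb 1$; put $E_\omega=M_\omega^*M_\omega$. Measuring $\rho$ yields a random outcome $R^M$ with $\mathbb P_\rho(R^M=\omega)=\operatorname{Tr}[\rho E_\omega]$ and, if this is positive, the post-measurement state $\rho_{M\to\omega}=M_\omega\rho M_\omega^*/\operatorname{Tr}[\rho E_\omega]$. With $\|A\|_{Tr}=\frac12\operatorname{Tr}|A|$, $M$ is $\alpha$-gentle on $\mathcal S\subseteq\mathcal S(\mathbb C^d)$ if $\|\rho-\rho_{M\to\omega}\|_{Tr}\le\alpha$ for all $\rho\in\mathcal S$ and all outcomes $\omega$ (of positive probability). $M$ is $\delta$-quantum-differentially-private on $\mathcal S$ if $\mathbb P_{\rho_1}(R^M=\omega)\le e^\delta\,\mathbb P_{\rho_2}(R^M=\omega)$ for all $\rho_1,\rho_2\in\mathcal S$ and $\omega\in\Omega$. *)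

(* Defs.v *)
From HB Require Import structures.
From mathcomp Require Import all_boot all_order all_algebra.
From mathcomp Require Import finmap complex.
From mathcomp Require Import all_classical all_reals all_analysis.
From mathcomp Require Import sesquilinear spectral.
From mathcomp.analysis Require Import showcase.summability.

Set Implicit Arguments.
Unset Strict Implicit.
Unset Printing Implicit Defensive.

Import Order.TTheory GRing.Theory Num.Theory.
Import numFieldNormedType.Exports.
Local Open Scope classical_set_scope.
Local Open Scope ring_scope.
Local Open Scope complex_scope.
Local Open Scope sesquilinear_scope.

(* In a numClosedFieldType, in particular in R[i], x <= y means that y - x is
   a nonnegative real. Traces below that are real are kept in C and compared
   with this order. *)

Section Matrices.
Variables (C : numClosedFieldType) (d : nat).
Implicit Types A rho : 'M[C]_d.

Definition psdmx A : Prop :=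
  A \is hermsymmx /\ forall v : 'cV[C]_d, 0 <= (v^t* *m A *m v) 0 0.

Definition posdefmx A : Prop :=
  A \is hermsymmx /\
  forall v : 'cV[C]_d, v != 0 -> 0 < (v^t* *m A *m v) 0 0.

(* Square root by functional calculus; the junk value when A is not normal is
   irrelevant here, since sqrtmx is applied to positive semidefinite A only. *)
Definition sqrtmx A : 'M[C]_d :=
  invmx (spectralmx A) *m diag_mx (map_mx sqrtC (spectral_diag A))
    *m spectralmx A.

Definition absmx A : 'M[C]_d := sqrtmx (A^t* *m A).

Definition trnorm A : C := 2^-1 * \tr (absmx A).

Definition density : set 'M[C]_d := [set rho | psdmx rho /\ \tr rho = 1].

Section Measurements.
Variables (Omega : countType) (M : Omega -> 'M[C]_d).
Implicit Type w : Omega.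

Definition effect w : 'M[C]_d := (M w)^t* *m M w.

(* The sum over the possibly infinite Omega is the unconditional one, i.e. the
   limit along the finite subsets of Omega ordered by inclusion. *)
Definition is_measurement : Prop :=
  (fun A : {fset Omega} => \sum_(w <- A) effect w) @ totally
    --> (1%:M : 'M[C]_d).

Definition outcome_prob rho w : C := \tr (rho *m effect w).

Definition post_state rho w : 'M[C]_d :=
  (outcome_prob rho w)^-1 *: (M w *m rho *m (M w)^t*).

End Measurements.

End Matrices.

Section Privacy.
Variables (R : realType) (d : nat) (Omega : countType).
Variable M : Omega -> 'M[R[i]]_d.

Definition gentle (alpha : R) (S : set 'M[R[i]]_d) : Prop :=
  forall rho w, S rho -> 0 < outcome_prob M rho w ->
    trnorm (rho - post_state M rho w) <= alpha%:C.

Definition quantum_dp (delta : R) (S : set 'M[R[i]]_d) : Prop :=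
  forall rho1 rho2 w, S rho1 -> S rho2 ->
    outcome_prob M rho1 w <= (expR delta)%:C * outcome_prob M rho2 w.

End Privacy.

Definition tanh (R : realType) (x : R) : R :=
  (expR x - expR (- x)) / (expR x + expR (- x)).

(* The preimage of y under the injective function tanh, and 0 (junk) outside
   of the range ]-1, 1[ of tanh. *)
Definition artanh (R : realType) (y : R) : R := xget 0 [set x | tanh x = y].

(* Main.v *)
Require Import Defs.
From mathcomp Require Import all_boot all_order all_algebra.
From mathcomp Require Import complex.
From mathcomp Require Import all_classical all_reals all_analysis.
From mathcomp Require Import sesquilinear spectral.
From mathcomp Require Import ring lra.

Set Implicit Arguments.
Unset Strict Implicit.
Unset Printing Implicit Defensive.

Import Order.TTheory GRing.Theory Num.Theory.

Local Open Scope ring_scope.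
Local Open Scope complex_scope.
Local Open Scope sesquilinear_scope.

(** Fix an outcome w and diagonalise the positive-definite matrix M w in an
    orthonormal eigenbasis u_i, with eigenvalues x_i > 0.

    Gentleness bounds the ratios x_i / x_j. For eigenvalues x > y with
    eigenvectors u and v, test it on the pure state psi = a u + b v with
    a^2 = y / (x + y) and b^2 = x / (x + y). These weights minimise the overlap
    of psi with the normalised vector M w psi / |M w psi|, the minimum being
    2 sqrt(x y) / (x + y). The trace distance of two pure states with overlap c
    is sqrt(1 - c^2), which here equals (x - y) / (x + y). So gentleness gives
    (x - y) / (x + y) <= alpha, that is x / y <= (1 + alpha) / (1 - alpha)
    ([gentleness_gap], [gentle_spectral_ratio]).

    In turn, the ratios control privacy. The probability of w in the state
    rho is the average of the x_i^2 with weights u_i^* rho u_i, nonnegative and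
    of sum 1; two averages of the same numbers differ at most by the factor
    max x_i^2 / min x_j^2 ([ratio_bound_privacy]). Squaring the first bound
    gives exp delta = ((1 + alpha) / (1 - alpha))^2.

    The trace distance is computed without diagonalising the difference
    X = P - Q of two rank-one projections: X is Hermitian with X^3 = t^2 X, so
    all eigenvalues of X^* X = X^2 are 0 or t^2, and on those two values the
    square root is division by t. Hence Tr |X| = Tr (X^2) / t
    ([trnorm_cubic], [trnorm_proj_sub]). *)

(** * Adjoints of complex matrices *)

Section Adjoint.
Variable C : numClosedFieldType.

Lemma adjmxM m n p (A : 'M[C]_(m, n)) (B : 'M[C]_(n, p)) :
  (A *m B)^t* = B^t* *m A^t*.
Proof. by rewrite trmx_mul map_mxM. Qed.

Lemma adjmxD m n (A B : 'M[C]_(m, n)) : (A + B)^t* = A^t* + B^t*.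
Proof. by rewrite linearD /= map_mxD. Qed.

Lemma adjmxB m n (A B : 'M[C]_(m, n)) : (A - B)^t* = A^t* - B^t*.
Proof. by rewrite linearB /= map_mxB. Qed.

Lemma adjmxZ m n a (A : 'M[C]_(m, n)) : (a *: A)^t* = a^* *: A^t*.
Proof. by rewrite linearZ /= map_mxZ. Qed.

Lemma hermsymmxP n (A : 'M[C]_n) : A \is hermsymmx <-> A^t* = A.
Proof.
split=> [/is_hermitianmxP|hA]; first by rewrite expr0 scale1r => <-.
by apply/is_hermitianmxP; rewrite expr0 scale1r hA.
Qed.

Lemma adjmx_mul_ge0 n (v : 'cV[C]_n) : 0 <= (v^t* *m v) 0 0.
Proof.
rewrite mxE sumr_ge0 // => k _; rewrite !mxE mulrC; exact: mul_conjC_ge0.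
Qed.

End Adjoint.

(** * The trace distance of two pure states *)

Section TraceNorm.
Variables (C : numClosedFieldType) (d : nat).

(** The trace norm is defined through a diagonalisation of X^* X whose
    eigenvalues are not accessible individually. The cubic identity makes the
    square root linear on them, so that only the trace of X^2 matters. *)
Lemma trnorm_cubic (X : 'M[C]_d) t :
    0 < t -> X^t* = X -> X *m X *m X = t ^+ 2 *: X ->
  trnorm X = \tr (X *m X) / (2 * t).
Proof.
move=> t0 hX X3.
have [A defA] : exists A, A = X *m X by exists (X *m X).
have hA : A^t* = A by rewrite defA adjmxM hX.
have A2 : A *m A = t ^+ 2 *: A by rewrite defA mulmxA X3 -scalemxAl.
have nA : A \is normalmx by apply/hermitian_normalmx/hermsymmxP.
move/orthomx_spectralP: (nA) => EA.
rewrite /trnorm /absmx hX -defA /sqrtmx.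
set U := spectralmx A in EA *; set s := spectral_diag A in EA *.
have UU : U \in unitmx by apply: spectral_unit.
have trE (v : 'rV[C]_d) : \tr (invmx U *m diag_mx v *m U) = \sum_i v 0 i.
  by rewrite mxtrace_mulC mulmxA mulmxV // mul1mx mxtrace_diag.
have s2 i : s 0 i ^+ 2 = t ^+ 2 * s 0 i.
  have EU : diag_mx s = U *m A *m invmx U.
    by rewrite EA !mulmxA mulmxV // mul1mx mulmxK.
  have : diag_mx s *m diag_mx s = t ^+ 2 *: diag_mx s.
    rewrite EU -!mulmxA mulKmx // (mulmxA A A) A2.
    by rewrite -scalemxAl -scalemxAr.
  move=> /matrixP /(_ i i); rewrite mulmx_diag !mxE eqxx !mulr1n.
  by rewrite expr2.
have root_s i : sqrtC (s 0 i) = s 0 i / t.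
  have /eqP := s2 i; rewrite expr2 -subr_eq0 -mulrBl mulf_eq0 subr_eq0.
  case/orP => /eqP ->; last by rewrite sqrtC0 mul0r.
  by rewrite sqrCK ?ltW // expr2 mulfK // gt_eqF.
rewrite trE [in RHS]EA trE invfM mulrCA; congr (_ * _).
by rewrite mulr_suml; apply: eq_bigr => i _; rewrite mxE root_s.
Qed.

(** For rank-one projections 1 - t^2 is the squared overlap, and
    PQP = (1 - t^2) P gives (P - Q)^3 = P - Q - PQP + QPQ = t^2 (P - Q). *)
Lemma trnorm_proj_sub (P Q : 'M[C]_d) t :
    0 < t -> P^t* = P -> Q^t* = Q -> P *m P = P -> Q *m Q = Q ->
    \tr P = 1 -> \tr Q = 1 ->
    P *m Q *m P = (1 - t ^+ 2) *: P -> Q *m P *m Q = (1 - t ^+ 2) *: Q ->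
  trnorm (P - Q) = t.
Proof.
move=> t0 hP hQ PP QQ trP trQ PQP QPQ.
have X2 : (P - Q) *m (P - Q) = P - P *m Q - Q *m P + Q.
  by rewrite mulmxBl !mulmxBr PP QQ opprB addrA addrAC.
rewrite (trnorm_cubic t0); last 2 first.
- by rewrite adjmxB hP hQ.
- rewrite X2 mulmxDl !mulmxBl !mulmxBr PP QQ PQP QPQ.
  rewrite -!(mulmxA _ P P) -!(mulmxA _ Q Q) PP QQ.
  rewrite !scalerBl !scale1r scalerBr.
  by apply/matrixP => i j; rewrite !mxE; ring.
rewrite X2 !(linearD, linearN) /= trP trQ.
have -> : \tr (P *m Q) = 1 - t ^+ 2.
  by rewrite -{1}PP -mulmxA mxtrace_mulC PQP linearZ /= trP mulr1.
have -> : \tr (Q *m P) = 1 - t ^+ 2.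
  by rewrite -{1}QQ -mulmxA mxtrace_mulC QPQ linearZ /= trQ mulr1.
by field; rewrite gt_eqF.
Qed.

End TraceNorm.

(** * The pure state that is disturbed the most *)

Section PureStates.
Variables (C : numClosedFieldType) (d : nat).
Implicit Types u v psi : 'cV[C]_d.

Lemma pure_density psi : psi^t* *m psi = 1%:M -> density (psi *m psi^t*).
Proof.
move=> psi1; split; last first.
  by rewrite mxtrace_mulC psi1 mxtrace1.
split; first by apply/hermsymmxP; rewrite adjmxM trmxCK.
move=> v; rewrite mulmxA -mulmxA.
have -> : v^t* *m psi = (psi^t* *m v)^t* by rewrite adjmxM trmxCK.
exact: adjmx_mul_ge0.
Qed.

Lemma dot_comb u v (a b a' b' : C) :
    u^t* *m u = 1%:M -> v^t* *m v = 1%:M ->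
    u^t* *m v = 0 -> v^t* *m u = 0 ->
  (a *: u + b *: v)^t* *m (a' *: u + b' *: v) = (a^* * a' + b^* * b')%:M.
Proof.
move=> uu vv uv vu; rewrite adjmxD !adjmxZ mulmxDl !mulmxDr.
rewrite -!scalemxAl -!scalemxAr uu vv uv vu !scaler0 addr0 add0r.
by rewrite !scalerA !scalemx1 raddfD.
Qed.

(** Only psi is a unit vector: phi stands for the unnormalised
    post-measurement vector, and p for its squared norm, the probability of the
    outcome. *)
Lemma trnorm_pure_sub (psi phi : 'cV[C]_d) (p o t : C) :
    0 < t -> 0 < p -> o \is Num.real ->
    psi^t* *m psi = 1%:M -> phi^t* *m phi = p%:M -> psi^t* *m phi = o%:M ->
    o ^+ 2 / p = 1 - t ^+ 2 ->
  trnorm (psi *m psi^t* - p^-1 *: (phi *m phi^t*)) = t.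
Proof.
move=> t0 p0 oR psi1 phip psiphi ot.
have phipsi : phi^t* *m psi = o%:M.
  rewrite -[LHS]trmxCK adjmxM trmxCK psiphi tr_scalar_mx map_scalar_mx /=.
  by rewrite conj_Creal.
have pN0 : p != 0 by rewrite gt_eqF.
apply: trnorm_proj_sub => //.
- by rewrite adjmxM trmxCK.
- by rewrite adjmxZ adjmxM trmxCK conj_Creal // rpredV gtr0_real.
- by rewrite -mulmxA (mulmxA _ psi) psi1 mul1mx.
- rewrite -scalemxAl -scalemxAr -mulmxA (mulmxA _ phi) phip mul_scalar_mx.
  by rewrite -scalemxAr scalerA mulVf // scale1r.
- by rewrite mxtrace_mulC psi1 mxtrace1.
- by rewrite linearZ /= mxtrace_mulC phip mxtrace_scalar mulVf.
- rewrite -scalemxAr -scalemxAl -!mulmxA (mulmxA _ psi) phipsi.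
  rewrite mul_scalar_mx -!scalemxAr (mulmxA _ phi) psiphi mul_scalar_mx.
  by rewrite -!scalemxAr !scalerA -ot; congr (_ *: _); ring.
- rewrite -!scalemxAl -!scalemxAr -!mulmxA (mulmxA _ psi) phipsi.
  rewrite mul_scalar_mx -!scalemxAr (mulmxA _ phi) psiphi mul_scalar_mx.
  by rewrite -!scalemxAr !scalerA -ot; congr (_ *: _); ring.
Qed.

(** The witness is the projection on the unit vector a u + b v whose squared
    coefficients are inversely proportional to the eigenvalues. Then M w maps it
    to a vector of squared norm x y whose inner product with it is the harmonic
    mean 2 x y / (x + y). *)
Lemma gentleness_gap (Omega : countType) (M : Omega -> 'M[C]_d) w u v
    (x y : C) :
    u^t* *m u = 1%:M -> v^t* *m v = 1%:M ->
    u^t* *m v = 0 -> v^t* *m u = 0 ->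
    M w *m u = x *: u -> M w *m v = y *: v -> 0 < y -> y < x ->
  exists rho, [/\ density rho, 0 < outcome_prob M rho w &
    trnorm (rho - post_state M rho w) = (x - y) / (x + y)].
Proof.
move=> uu vv uv vu Mu Mv y0 yx.
have x0 : 0 < x := lt_trans y0 yx.
have xy0 : 0 < x + y by rewrite addr_gt0.
have xyN0 : x + y != 0 by rewrite gt_eqF.
pose a := sqrtC (y / (x + y)); pose b := sqrtC (x / (x + y)).
have a0 : 0 <= a by rewrite sqrtC_ge0 divr_ge0 // ltW.
have b0 : 0 <= b by rewrite sqrtC_ge0 divr_ge0 // ltW.
have aa : a * a = y / (x + y) by rewrite -expr2 sqrtCK.
have bb : b * b = x / (x + y) by rewrite -expr2 sqrtCK.
pose psi := a *: u + b *: v.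
have Mpsi : M w *m psi = (a * x) *: u + (b * y) *: v.
  by rewrite mulmxDr -!scalemxAr Mu Mv !scalerA.
have psi1 : psi^t* *m psi = 1%:M.
  rewrite dot_comb // !conj_Creal ?ger0_real // aa bb.
  by congr (_%:M); field.
have normM : (M w *m psi)^t* *m (M w *m psi) = (x * y)%:M.
  rewrite Mpsi dot_comb // !conj_Creal ?ger0_real ?mulr_ge0 // ?ltW //.
  rewrite (mulrACA a) (mulrACA b) aa bb.
  by congr (_%:M); field.
have overlap : psi^t* *m (M w *m psi) = (2 * x * y / (x + y))%:M.
  rewrite Mpsi dot_comb // !conj_Creal ?ger0_real // !mulrA aa bb.
  by congr (_%:M); field.
exists (psi *m psi^t*).
have prob : outcome_prob M (psi *m psi^t*) w = x * y.
  rewrite /outcome_prob /effect -mulmxA mxtrace_mulC -!mulmxA mulmxA.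
  by rewrite -adjmxM normM mxtrace_scalar.
split; first exact: pure_density.
  by rewrite prob mulr_gt0.
rewrite /post_state prob -(mulmxA (M w)) -(mulmxA psi) -adjmxM mulmxA.
apply: (trnorm_pure_sub _ _ _ psi1 normM overlap).
- by rewrite divr_gt0 // subr_gt0.
- by rewrite mulr_gt0.
- by rewrite ger0_real // divr_ge0 ?mulr_ge0 ?ltW.
- by field; rewrite !gt_eqF.
Qed.

End PureStates.

(** * Outcome probabilities in an eigenbasis *)

Section Spectral.
Variables (C : numClosedFieldType) (d : nat).
Implicit Types A : 'M[C]_d.

Lemma col_mulmx m n p (A : 'M[C]_(m, n)) (B : 'M[C]_(n, p)) j :
  col j (A *m B) = A *m col j B.
Proof. by rewrite !colE mulmxA. Qed.

(** The spectral theorem is stated as A = U^-1 D U for the unitary matrix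
    U = spectralmx A, so the eigenvectors are the columns of U^-1 = U^*, not
    those of U. *)
Definition eigvec A (i : 'I_d) : 'cV[C]_d := col i ((spectralmx A)^t*).

Lemma eigvec_adj A i : (eigvec A i)^t* = row i (spectralmx A).
Proof. by apply/matrixP => k l; rewrite !mxE conjCK. Qed.

Lemma eigvec_dot A i j :
  (eigvec A i)^t* *m eigvec A j = ((i == j)%:R)%:M.
Proof.
rewrite eigvec_adj -row_mul -col_mulmx.
have /unitarymxP -> := spectral_unitarymx A.
by apply/matrixP => k l; rewrite !mxE !ord1 eqxx.
Qed.

Lemma eigvecE A i : A \is normalmx ->
  A *m eigvec A i = spectral_diag A 0 i *: eigvec A i.
Proof.
move=> /orthomx_spectralP EA.
rewrite {1}EA -!mulmxA -col_mulmx.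
have /unitarymxP -> := spectral_unitarymx A.
rewrite invmx_unitary ?spectral_unitarymx //.
rewrite -col_mulmx mulmx1.
apply/matrixP => k l; rewrite !mxE.
under eq_bigr => j _ do rewrite !mxE.
rewrite (bigD1 i) //= big1 ?addr0; last first.
  by move=> j /negPf ji; rewrite ji mulr0n mulr0.
by rewrite eqxx mulr1n mulrC.
Qed.

Lemma posdefmx_spectral_gt0 A i : posdefmx A -> 0 < spectral_diag A 0 i.
Proof.
case=> hA Apos.
have dot1 := eigvec_dot A i i; rewrite eqxx in dot1.
have /Apos : eigvec A i != 0.
  apply/eqP => e0; move: dot1; rewrite e0 mulmx0 => /matrixP /(_ 0 0) /eqP.
  by rewrite !mxE eqxx eq_sym oner_eq0.
rewrite -mulmxA eigvecE ?hermitian_normalmx // -scalemxAr dot1.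
by rewrite !mxE eqxx mulr1.
Qed.

Lemma mxtrace_eigvec A (B : 'M[C]_d) :
  \tr B = \sum_i ((eigvec A i)^t* *m B *m eigvec A i) 0 0.
Proof.
have UU : (spectralmx A)^t* *m spectralmx A = 1%:M.
  by rewrite -invmx_unitary ?spectral_unitarymx // mulVmx ?spectral_unit.
rewrite -[B in LHS]mulmx1 -UU mulmxA mxtrace_mulC mulmxA /mxtrace.
apply: eq_bigr => i _; rewrite eigvec_adj -row_mul -col_mulmx.
by rewrite !mxE; apply: eq_bigr => j _; rewrite !mxE.
Qed.

Lemma outcome_prob_spectral (Omega : countType) (M : Omega -> 'M[C]_d) rho w :
    M w \is hermsymmx ->
  outcome_prob M rho w = \sum_i
    ((eigvec (M w) i)^t* *m rho *m eigvec (M w) i) 0 0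
      * spectral_diag (M w) 0 i ^+ 2.
Proof.
move=> hM; have nM := hermitian_normalmx hM.
rewrite /outcome_prob (mxtrace_eigvec (M w)); apply: eq_bigr => i _.
rewrite /effect; move/hermsymmxP: hM => ->.
rewrite -!mulmxA eigvecE // -scalemxAr eigvecE // -!scalemxAr !mxE expr2.
ring.
Qed.

End Spectral.

(** * Gentleness, eigenvalue ratios and privacy *)

(** Since the weights of each state sum to 1, both probabilities become double
    sums over the same pairs of weights and can be compared term by term. *)
Lemma ratio_bound_privacy (R : realType) (d : nat) (Omega : countType)
    (M : Omega -> 'M[R[i]]_d) (delta : R) :
    (forall w, M w \is hermsymmx) ->
    (forall w i j, spectral_diag (M w) 0 i ^+ 2
       <= (expR delta)%:C * spectral_diag (M w) 0 j ^+ 2) ->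
  quantum_dp M delta (@density R[i] d).
Proof.
move=> hM ratio rho1 rho2 w [[_ pos1] tr1] [[_ pos2] tr2].
rewrite !outcome_prob_spectral //.
rewrite (mxtrace_eigvec (M w)) in tr1; rewrite (mxtrace_eigvec (M w)) in tr2.
(* The factors 1 are the total weights of the other state. *)
rewrite -[leLHS]mulr1 -{}tr2 -[leRHS]mul1r -{}tr1.
rewrite !mulr_suml; apply: ler_sum => i _.
rewrite !mulr_sumr; apply: ler_sum => j _.
rewrite mulrAC (mulrCA _%:C) [leRHS]mulrA.
by apply: ler_wpM2l => //; rewrite mulr_ge0 ?pos1 ?pos2.
Qed.

Lemma gentle_spectral_ratio (R : realType) (d : nat) (Omega : countType)
    (M : Omega -> 'M[R[i]]_d) (alpha : R) w i j :
    0 <= alpha < 1 -> gentle M alpha (@density R[i] d) -> posdefmx (M w) ->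
  spectral_diag (M w) 0 i
    <= ((1 + alpha) / (1 - alpha))%:C * spectral_diag (M w) 0 j.
Proof.
move=> /andP[a0 a1] Mgentle Mpos.
have [hM _] := Mpos; have nM := hermitian_normalmx hM.
have xi0 := posdefmx_spectral_gt0 i Mpos.
have xj0 := posdefmx_spectral_gt0 j Mpos.
set x := spectral_diag (M w) 0 i in xi0 *.
set y := spectral_diag (M w) 0 j in xj0 *.
have k0 : 0 <= alpha%:C by rewrite lecR.
have k1 : 0 < 1 - alpha%:C.
  by rewrite subr_gt0 -[1]/(1%:C) ltcR.
have -> : ((1 + alpha) / (1 - alpha))%:C = (1 + alpha%:C) / (1 - alpha%:C).
  by rewrite rmorphM fmorphV rmorphD rmorphB rmorph1.
rewrite mulrAC ler_pdivlMr //.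
(* The factor is at least 1, so only y < x needs gentleness. *)
have [xy|yx] := real_leP (gtr0_real xi0) (gtr0_real xj0).
  apply: le_trans (_ : x <= _); first by rewrite ler_piMr ?(ltW xi0) // gerBl.
  by apply: le_trans xy _; rewrite ler_peMl ?(ltW xj0) // lerDl.
have ij : i != j by apply: contraTneq yx => ij; rewrite /x /y ij ltxx.
have dij := eigvec_dot (M w) i j; rewrite (negPf ij) raddf0 in dij.
have dji := eigvec_dot (M w) j i; rewrite eq_sym (negPf ij) raddf0 in dji.
have dii := eigvec_dot (M w) i i; rewrite eqxx in dii.
have djj := eigvec_dot (M w) j j; rewrite eqxx in djj.
have [rho [rhoD prho tn]] := gentleness_gap dii djj dij dji
  (eigvecE i nM) (eigvecE j nM) xj0 yx.
have := Mgentle _ _ rhoD prho; rewrite tn ler_pdivrMr ?addr_gt0 // -/x -/y.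
rewrite -subr_ge0 => h; rewrite -subr_ge0.
by have -> : (1 + alpha%:C) * y - x * (1 - alpha%:C)
  = alpha%:C * (x + y) - (x - y) by ring.
Qed.

(** Both existence and uniqueness of the preimage follow from
    tanh x = (e^(2x) - 1) / (e^(2x) + 1), a Moebius function of e^(2x) with
    inverse y |-> (1 + y) / (1 - y). *)
Lemma artanhE (R : realType) (y : R) : -1 < y < 1 ->
  artanh y = ln ((1 + y) / (1 - y)) / 2.
Proof.
move=> /andP[yN1 y1].
have q0 : 0 < (1 + y) / (1 - y) by rewrite divr_gt0 //; lra.
have tanhE (x : R) : tanh x = (expR (x * 2) - 1) / (expR (x * 2) + 1).
  have e0 := expR_gt0 x.
  rewrite /tanh expRN (_ : x * 2 = x + x) ?expRD; last by ring.
  by field; rewrite !gt_eqF // ?addr_gt0 ?mulr_gt0.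
apply: xget_unique => /=.
  rewrite tanhE divfK // lnK ?posrE //.
  by field; rewrite !gt_eqF //; lra.
move=> x; rewrite tanhE => yE.
have e0 := expR_gt0 (x * 2).
have -> : (1 + y) / (1 - y) = expR (x * 2).
  by rewrite -yE; field; rewrite !gt_eqF //; lra.
by rewrite expRK mulfK.
Qed.

Theorem lemma2 (R : realType) (d : nat) (Omega : countType)
    (M : Omega -> 'M[R[i]]_d) (alpha : R) :
  0 <= alpha < 1 ->
  is_measurement M ->
  gentle M alpha (@density R[i] d) ->
  (forall w, posdefmx (M w)) ->
  quantum_dp M (2 * ln ((1 + alpha) / (1 - alpha))) (@density R[i] d) /\
  2 * ln ((1 + alpha) / (1 - alpha)) = 4 * artanh alpha.
Proof.
move=> alpha01 _ Mgentle Mpos; have /andP[a0 a1] := alpha01.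
split; last by rewrite artanhE; [field | lra].
have q0 : 0 < (1 + alpha) / (1 - alpha) by rewrite divr_gt0 //; lra.
apply: ratio_bound_privacy => [w|w i j]; first by case: (Mpos w).
rewrite mulr_natl mulr2n expRD lnK ?posrE // -expr2 rmorphXn -exprMn.
have xi0 := posdefmx_spectral_gt0 i (Mpos w).
rewrite lerXn2r ?nnegrE ?(ltW xi0) //; last exact: gentle_spectral_ratio.
exact: le_trans (ltW xi0) (gentle_spectral_ratio _ _ alpha01 Mgentle (Mpos w)).
Qed.
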